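(* Let $v_1,v_2$ be two stochastic processes with continuous paths and let $e=v_1-v_2$. Let $h>0$ be a parameter, and denote by $\tau$ the stopping time defined for $T>0$ and $\gamma>0$ by $$\tau=T\wedge\inf\{t>0:\ |v_1(t)|>h^{-\gamma}\ \text{or}\ |v_2(t)|>h^{-\gamma}\}.$$ Suppose that for some $C_\star>0$ and $p>0$ $$\mathbb{E}\sup_{[0,T]}|v_1|^p\le C_\star\quad\text{and}\quad \mathbb{E}\sup_{[0,T]}|v_2|^p\le C_\star,$$ and that for $s>p$ $$\sup_{[0,T]}\mathbb{E}|v_1|^s\le C_\star\quad\text{and}\quad \sup_{[0,T]}\mathbb{E}|v_2|^s\le C_\star .$$ Moreover, assume that $\mathbb{E}\sup_{[0,\tau]}|e|^2\le h^{2\delta}$ for some $\delta>0$. Then, for $q>0$, $$\sup_{t\in[0,T]}\mathbb{E}|e(t)|^q\le \mathrm{Const}\cdot\Bigl[h^{(\delta-\frac{\gamma p}{2})q}+h^{\gamma p\,\frac{s-q}{s}}\Bigr],$$ and the effective optimal rate is the minimum of both exponents. If, in addition, $\delta=\frac{1-\rho\gamma}{2}$ for some $\rho>0$ such that $\delta>0$, then $$\Bigl(\sup_{t\in[0,T]}\mathbb{E}|e(t)|^q\Bigr)^{1/q}\le C\cdot h^{\frac{p(s-q)}{2p(s-q)+(p+\rho)qs}} ,$$ which amounts to an effective rate of $1/2$ for $q\to0$.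
   Context: $a\wedge b$ denotes $\min\{a,b\}$. The parameter $h$ is thought of as small (a step size), the processes may depend on $h$, and the estimates are rates in $h$, i.e. the constants $\mathrm{Const}$ and $C$ do not depend on $h$.
   Formalization: The bounds are stated for 0 < q ≤ s (for q > s the moment E|e|^q can be infinite), and in the last part γ is the admissible value maximising the minimum of both exponents (for a fixed small γ the stated rate fails). *)

(* Defs.v *)
From HB Require Import structures.
From mathcomp Require Import all_boot all_order all_algebra.
From mathcomp Require Import all_classical all_reals all_analysis.
Set Implicit Arguments.
Unset Strict Implicit.
Unset Printing Implicit Defensive.
Import Order.TTheory GRing.Theory Num.Theory.
Import numFieldNormedType.Exports.
Local Open Scope classical_set_scope.
Local Open Scope ring_scope.

Section Processes.
Context (R : realType) (V : normedModType R).
Context (d : measure_display) (Omega : measurableType d).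
Context (P : probability Omega R).
Implicit Types (T h gamma : R) (v : R -> Omega -> V).

(* Random variables with values in V are measurable for the Borel sigma-algebra
   of V, i.e. the one generated by the open sets. When V is second countable,
   differences of random variables are then random variables as well. *)
Definition continuous_process T v : Prop :=
  (forall t, t \in `[0, T] ->
     measurable_fun [set: Omega] (v t : Omega -> g_sigma_algebraType (@open V)))
  /\ (forall w, {within `[0, T], continuous (fun t => v t w)}).

(* The infimum is taken in the extended reals, so that it is +oo (and the
   minimum is T) when the level h^(-gamma) is never exceeded. *)
Definition exit_time T h gamma (v1 v2 : R -> Omega -> V) (w : Omega) : \bar R :=
  Order.min T%:E
    (ereal_inf [set t%:E | t in [set t : R | 0 < t /\
       (h `^ (- gamma) < `|v1 t w| \/ h `^ (- gamma) < `|v2 t w|)]]).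

Definition E_sup T v (p : R) : \bar R :=
  (\int[P]_w ereal_sup [set (`|v t w| `^ p)%:E | t in `[0%R, T]])%E.

Definition sup_E T v (p : R) : \bar R :=
  ereal_sup [set ('E_P[fun w => (`|v t w| `^ p)%R])%E | t in `[0%R, T]].

Definition E_sup_until (tau : Omega -> \bar R) v (p : R) : \bar R :=
  (\int[P]_w
     ereal_sup [set (`|v t w| `^ p)%:E
               | t in [set t : R | (0 <= t)%R /\ (t%:E <= tau w)%E]])%E.

Definition moment_bounds T (p s Cstar : R) v : Prop :=
  (E_sup T v p <= Cstar%:E)%E /\ (sup_E T v s <= Cstar%:E)%E.

Definition error (v1 v2 : R -> Omega -> V) : R -> Omega -> V := fun t w => v1 t w - v2 t w.

Definition truncated_setting T (p s Cstar gamma delta h : R)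
    (v1 v2 : R -> Omega -> V) : Prop :=
  [/\ continuous_process T v1 /\ continuous_process T v2,
      moment_bounds T p s Cstar v1,
      moment_bounds T p s Cstar v2 &
      (E_sup_until (exit_time T h gamma v1 v2) (error v1 v2) 2
         <= (h `^ (2 * delta))%:E)%E].

End Processes.

Section Rates.
Context (R : realType).
Implicit Types (p s q gamma delta rho : R).

Definition exponent_before p gamma delta q : R := (delta - gamma * p / 2) * q.

Definition exponent_after p s gamma q : R := gamma * p * ((s - q) / s).

Definition min_exponent p s gamma delta q : R :=
  Num.min (exponent_before p gamma delta q) (exponent_after p s gamma q).

(* With delta = (1 - rho * gamma) / 2 this is q^-1 times the common value of the
   two exponents above at the gamma for which they coincide. *)
Definition optimized_rate p s rho q : R :=
  (p * (s - q)) / (2 * p * (s - q) + (p + rho) * q * s).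

(* r is the best exponent for which f h = O(h^r) as h tends to 0 from above. *)
Definition is_effective_rate (f : R -> R) (r : R) : Prop :=
  f =O_ ((0 : R)^'+) (fun h : R => h `^ r) /\
  (forall r', f =O_ ((0 : R)^'+) (fun h : R => h `^ r') -> r' <= r).

End Rates.

(* Main.v *)
Require Import Defs.
From HB Require Import structures.
From mathcomp Require Import all_boot all_order all_algebra.
From mathcomp Require Import all_classical all_reals all_analysis.
From mathcomp Require Import measurable_realfun ring lra.
Set Implicit Arguments.
Unset Strict Implicit.
Unset Printing Implicit Defensive.
Import Order.TTheory GRing.Theory Num.Theory.
Import numFieldNormedType.Exports.
Local Open Scope classical_set_scope.
Local Open Scope ring_scope.

(* Fix t in [0, T] and let A be the event that |v1| or |v2| exceeds h^(-gamma)
   before time t. By Markov's inequality P(A) <= 2 C h^(gamma p), and off A one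
   has t <= tau. Instead of Hoelder's inequality we integrate the pointwise bound
   x^q <= l^(q-s) x^s + l^q, valid for all l > 0: with l = h^(-gamma p / s) it
   yields the exponent gamma p (s - q) / s on A. Off A, the same bound with
   (2, h^delta) in place of (s, l) yields h^(delta q) if q <= 2. If q > 2 and
   delta > gamma p / 2, then h^(2 delta) <= h^(gamma p) and one argues off A as on
   A, with |e|^2 in place of the indicator function; if delta <= gamma p / 2 and
   h <= 1 the first term of the rate is at least 1, and if h > 1 the second one
   is, so that the bound on the s-th moment suffices. *)

(** * Inequalities and asymptotics for real powers *)

Section Reals.
Context (R : realType).
Implicit Types (x y h l q s a b c r gamma delta p rho C D : R).

(** Below the level [l] the second term dominates; from [l] on, the first one does, because the
    exponent [q - s] is nonpositive and hence x^(q-s) <= l^(q-s). *)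
Lemma powR_interpolation x l q s : 0 <= x -> 0 < l -> 0 <= q <= s ->
  x `^ q <= l `^ (q - s) * x `^ s + l `^ q.
Proof.
move=> x0 l0 /andP[q0 qs]; have [xl|/ltW lx] := leP x l.
  by rewrite ler_wpDl ?mulr_ge0 ?powR_ge0// ge0_ler_powR// nnegrE ltW.
have x0' : 0 < x := lt_le_trans l0 lx.
rewrite ler_wpDr ?powR_ge0// -(opprB s q) powRN mulrC ler_pdivlMr ?powR_gt0//.
rewrite -[leRHS](_ : x `^ q * x `^ (s - q) = _); last first.
  by rewrite -powRD ?(gt_eqF x0') ?implybT//; congr (_ `^ _); ring.
rewrite ler_wpM2l ?powR_ge0// ge0_ler_powR ?nnegrE ?subr_ge0//; exact: ltW.
Qed.

(** Bounding the norm of the difference by twice the maximum treats all nonnegative [s] at once,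
    whereas convexity of the power would require s >= 1. *)
Lemma powR_normB (V : normedModType R) (x y : V) s : 0 <= s ->
  `|x - y| `^ s <= 2 `^ s * (`|x| `^ s + `|y| `^ s).
Proof.
move=> s0; have xy : `|x - y| <= 2 * Num.max `|x| `|y|.
  rewrite (le_trans (ler_normB x y))// mulr_natl mulr2n.
  by rewrite lerD// le_max lexx ?orbT.
have m0 : 0 <= Num.max `|x| `|y| by rewrite le_max normr_ge0.
apply: (@le_trans _ _ ((2 * Num.max `|x| `|y|) `^ s)).
  by rewrite ge0_ler_powR// nnegrE// mulr_ge0.
rewrite powRM// ler_wpM2l ?powR_ge0//.
by case: (leP `|x| `|y|) => _; rewrite ?lerDl ?lerDr powR_ge0.
Qed.

Lemma add_powR_le_min a b h : 0 < h <= 1 ->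
  h `^ a + h `^ b <= 2 * h `^ Num.min a b.
Proof.
move=> h01; rewrite mulr_natl mulr2n.
by rewrite lerD// ger_powR// ge_min lexx ?orbT.
Qed.

Lemma bigO_powR a b :
  (fun h => h `^ a + h `^ b) =O_ ((0 : R)^'+) (fun h => h `^ Num.min a b).
Proof.
apply/eqO_exP; exists 2 => //; near=> h.
have h0 : 0 < h by [].
have h1 : 0 < h <= 1 by rewrite h0/=; near: h; exact: nbhs_right_le.
by rewrite !ger0_norm ?addr_ge0 ?powR_ge0// add_powR_le_min.
Unshelve. all: end_near. Qed.

(** If [a] were less than [r], then h^(r-a) would tend to 0, whereas h^a <= k h^r keeps it above
    1/k. *)
Lemma bigO_powR_le a b r :
  (fun h => h `^ a + h `^ b) =O_ ((0 : R)^'+) (fun h => h `^ r) -> r <= a.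
Proof.
move=> /eqO_exP[k k0 kP]; rewrite leNgt; apply/negP => ar.
have := @powR_cvg0 R (r - a); rewrite subr_gt0 => /(_ ar) cvg0.
near (0 : R)^'+ => h.
have h0 : 0 < h by [].
have : h `^ (r - a) < k^-1.
  by near: h; move/cvgr_lt : cvg0; apply; rewrite invr_gt0.
have : `|h `^ a + h `^ b| <= k * `|h `^ r| by near: h.
rewrite !ger0_norm ?addr_ge0 ?powR_ge0// => hab.
apply/negP; rewrite -leNgt powRB ?(gt_eqF h0) ?implybT//.
rewrite ler_pdivlMr ?powR_gt0// ler_pdivrMl//.
by apply: le_trans hab; rewrite lerDl powR_ge0.
Unshelve. all: end_near. Qed.

Lemma is_effective_rate_powR a b :
  is_effective_rate (fun h => h `^ a + h `^ b) (Num.min a b).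
Proof.
split; first exact: bigO_powR.
move=> r hr; rewrite le_min (bigO_powR_le hr)/=.
apply: (@bigO_powR_le b a).
suff -> : (fun h => h `^ b + h `^ a) = (fun h => h `^ a + h `^ b) by [].
by apply/funext => h; rewrite addrC.
Qed.

(** The rational function is continuous at q = 0: its denominator there is 2ps, which is positive,
    and its value is ps / (2ps). *)
Lemma optimized_rate_cvg p s rho : 0 < p -> 0 < s ->
  optimized_rate p s rho q @[q --> 0^'+] --> (1 / 2 : R).
Proof.
move=> p0 s0; apply: cvg_at_right_filter.
have -> : (1 / 2 : R) = optimized_rate p s rho 0.
  by rewrite /optimized_rate; field; rewrite (gt_eqF p0) (gt_eqF s0).
rewrite /optimized_rate; apply: cvgM.
  apply: cvgMr; apply: cvgB; [exact: cvg_cst|exact: cvg_id].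
apply: cvgV.
  by rewrite mulr0 mul0r addr0 subr0 !mulf_neq0 ?(gt_eqF p0) ?(gt_eqF s0).
apply: cvgD.
  by apply: cvgMr; apply: cvgB; [exact: cvg_cst|exact: cvg_id].
by apply: cvgMl; apply: cvgMr; exact: cvg_id.
Qed.

End Reals.

(** * Choice of the weights in the pointwise bounds *)

Section Weights.
Context (R : realType).
Implicit Types (x h q s gamma delta p : R).

(* c1 and c2 weigh |e|^s and the indicator function of A; c1, c3 and c4 weigh
   |e|^s, |e|^2 and 1 off A. *)
Lemma interpolation_weights p s gamma delta q h :
  0 < p -> p < s -> 0 < gamma -> 0 < delta -> 0 < q <= s -> 0 < h ->
  let rate := h `^ exponent_before p gamma delta q +
              h `^ exponent_after p s gamma q in
  exists c1 c2 c3 c4 : R,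
  [/\ [/\ 0 <= c1, 0 <= c2, 0 <= c3 & 0 <= c4],
      forall x, 0 <= x -> x `^ q <= c1 * x `^ s + c2,
      forall x, 0 <= x -> x `^ q <= c1 * x `^ s + c3 * x `^ 2 + c4 &
      [/\ c1 <= rate, c2 * h `^ (gamma * p) <= rate,
          c3 * h `^ (2 * delta) <= rate & c4 <= rate]].
Proof.
move=> p0 ps g0 d0 /andP[q0 qs] h0; have s0 := lt_trans p0 ps.
have sN0 : s != 0 by rewrite gt_eqF.
have gp0 : 0 < gamma * p by rewrite mulr_gt0.
rewrite /exponent_before /exponent_after.
set b := (_ - _) * q; set a := gamma * p * _.
set rate := h `^ b + h `^ a.
(* This level balances the two terms: l^(q-s), which weighs the s-th moment, and l^q h^(gamma p),
   which comes from Markov's inequality, both equal h^a. *)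
pose l := h `^ (- (gamma * p / s)).
have l0 : 0 < l by rewrite powR_gt0.
have lE r : l `^ r = h `^ (- (gamma * p / s) * r) by rewrite -powRrM.
have hD x y : h `^ x * h `^ y = h `^ (x + y).
  by rewrite powRD// (gt_eqF h0) implybT.
have lqs : l `^ (q - s) = h `^ a by rewrite lE; congr (_ `^ _); rewrite /a; field.
have lqh : l `^ q * h `^ (gamma * p) = h `^ a.
  by rewrite lE hD; congr (_ `^ _); rewrite /a; field.
have a0 : 0 <= a by rewrite mulr_ge0 ?(ltW gp0)// divr_ge0 ?subr_ge0// ltW.
have interp x : 0 <= x -> x `^ q <= h `^ a * x `^ s + l `^ q.
  by move=> x0; rewrite -lqs powR_interpolation// (ltW q0).
have ha_rate : h `^ a <= rate by rewrite lerDr powR_ge0.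
have lqh_rate : l `^ q * h `^ (gamma * p) <= rate by rewrite lqh.
have hb_rate : h `^ b <= rate by rewrite lerDl powR_ge0.
have rate0 : 0 <= rate by rewrite addr_ge0 ?powR_ge0.
(* For h > 1 one has l^q <= 1 <= h^a, so that l^q is small enough to serve as the constant off the
   event too. *)
have [h1|h1] := ltP 1 h.
  have lq1 : l `^ q <= 1.
    by rewrite lE -(powRr0 h) ler_powR ?(ltW h1)// mulNr oppr_le0 mulr_ge0 ?divr_ge0 ?ltW.
  have ha1 : 1 <= h `^ a by rewrite -(powRr0 h) ler_powR// ltW.
  exists (h `^ a), (l `^ q), 0, (l `^ q); split.
  - by split; rewrite ?powR_ge0.
  - exact: interp.
  - by move=> x x0; rewrite mul0r addr0; exact: interp.
  - rewrite mul0r; split; [exact: ha_rate|exact: lqh_rate|exact: rate0|].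
    exact: le_trans lq1 (le_trans ha1 ha_rate).
have h01 : 0 < h <= 1 by rewrite h0.
(* If b <= 0, then h^b >= 1, and off the event interpolation at level 1 suffices. Its coefficient 1
   of x^s is added to [c1], which both bounds share. *)
have [dgp|gpd] := leP delta (gamma * p / 2).
  have hb1 : 1 <= h `^ b.
    by rewrite -(powRr0 h) ger_powR// mulr_le0_ge0 ?subr_le0// ltW.
  exists (h `^ a + 1), (l `^ q), 0, 1; split.
  - by rewrite addr_ge0 ?powR_ge0.
  - move=> x x0; apply: (le_trans (interp x x0)).
    by rewrite mulrDl mul1r -addrA lerD2l lerDr powR_ge0.
  - move=> x x0; rewrite mul0r addr0 mulrDl mul1r -addrA.
    rewrite ler_wpDl ?mulr_ge0 ?powR_ge0//.
    have := @powR_interpolation R x 1 q s x0 ltr01.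
    by rewrite !powR1 mul1r; apply; rewrite ltW.
  - rewrite mul0r; split; [|exact: lqh_rate|exact: rate0|exact: le_trans hb1 hb_rate].
    by rewrite addrC lerD2r.
(* For q <= 2, interpolation between 0 and 2 at level h^delta makes both c3 h^(2 delta) and [c4]
   equal to h^(delta q), which is at most h^b as b <= delta q. *)
have [q2|q2] := leP q 2.
  pose m := h `^ delta.
  have m0 : 0 < m by rewrite powR_gt0.
  have mq : m `^ q <= h `^ b.
    rewrite -powRrM ger_powR// ler_wpM2r ?(ltW q0)// gerDl oppr_le0.
    by rewrite divr_ge0// ltW.
  exists (h `^ a), (l `^ q), (m `^ (q - 2)), (m `^ q); split.
  - by split; exact: powR_ge0.
  - exact: interp.
  - move=> x x0; rewrite -addrA ler_wpDl ?mulr_ge0 ?powR_ge0//.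
    by rewrite powR_interpolation// (ltW q0).
  - split; [exact: ha_rate|exact: lqh_rate| |exact: le_trans mq hb_rate].
    rewrite (le_trans _ hb_rate)// (le_trans _ mq)// -!powRrM hD.
    by rewrite (_ : delta * (q - 2) + 2 * delta = delta * q)//; ring.
have l1 : 1 <= l.
  by rewrite -(powRr0 h) ger_powR// oppr_le0 divr_ge0 ?ltW.
exists (h `^ a), (l `^ q), (l `^ q), 0; split.
- by split; rewrite ?powR_ge0.
- exact: interp.
(* Below [l], x^q = x^(q-2) x^2 <= l^(q-2) x^2. Above it, x >= l >= 1, so the constant l^q of the
   first bound may be multiplied by x^2. *)
- move=> x x0; rewrite addr0; have [xl|/ltW lx] := leP x l.
    rewrite ler_wpDl ?mulr_ge0 ?powR_ge0//.
    have [->|xN0] := eqVneq x 0.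
      by rewrite !powR0 ?mulr0// gt_eqF.
    rewrite -[in leLHS](subrK 2 q) powRD ?xN0 ?implybT// ler_wpM2r ?powR_ge0//.
    apply: (@le_trans _ _ (l `^ (q - 2))).
      by rewrite ge0_ler_powR ?nnegrE ?subr_ge0// ltW.
    by rewrite ler_powR// gerBl.
  apply: (le_trans (interp x x0)); rewrite lerD2l ler_peMr ?powR_ge0//.
  by have := ler_powR (le_trans l1 lx) (ler0n R 2); rewrite powRr0.
- split; [exact: ha_rate|exact: lqh_rate| |exact: rate0].
  rewrite (le_trans _ lqh_rate)//.
  by rewrite ler_wpM2l ?powR_ge0// ger_powR//; move: gpd; lra.
Qed.

End Weights.

(** * Comparison of lower integrals *)

Section LowerIntegral.
Context (R : realType) (d : measure_display) (Omega : measurableType d).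
Context (mu : {measure set Omega -> \bar R}).
Local Open Scope ereal_scope.

(* The integral of a nonnegative function is a lower integral, so that the
   majorant need not be measurable. *)
Lemma ge0_le_lower_integral (f g : Omega -> \bar R) :
  (forall w, 0 <= f w) -> (forall w, f w <= g w) ->
  \int[mu]_w f w <= \int[mu]_w g w.
Proof.
move=> f0 fg; have g0 w : 0 <= g w := le_trans (f0 w) (fg w).
rewrite !ge0_integralTE//; apply: ereal_sup_le => _ [h hf <-].
by exists h => // w; exact: le_trans (hf w) (fg w).
Qed.

End LowerIntegral.

Lemma countable_bigcup_measurable (d : measure_display) (T : measurableType d)
    (I : Type) (D : set I) (F : I -> set T) : countable D ->
  (forall i, D i -> measurable (F i)) -> measurable (\bigcup_(i in D) F i).
Proof.
move=> cD mF; rewrite bigcup_set_type; apply: countable_bigcupT_measurable.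
  by rewrite (eq_countable (card_setT _)).
by move=> [i Di]; apply: mF; exact: set_mem Di.
Qed.

(** * Borel measurability of differences *)

Section BorelPairs.
Context (R : realType) (V : normedModType R).
Context (V_separable : @second_countable V).
Context (d : measure_display) (Omega : measurableType d).
Implicit Types X Y : Omega -> V.

Let borel_measurable X :=
  measurable_fun [set: Omega] (X : Omega -> g_sigma_algebraType (@open V)).

Lemma measurable_open_preimage X (U : set V) : borel_measurable X -> open U ->
  measurable [set w | U (X w)].
Proof.
move=> mX oU; have := mX measurableT U; rewrite setTI; apply.
exact: sub_sigma_algebra.
Qed.

(** A countable basis writes an open set of pairs as a countable union of boxes, and the preimage of
    a box is an intersection of two measurable events. *)
Lemma measurable_open_preimage_pair X Y (O : set (V * V)) :
  borel_measurable X -> borel_measurable Y -> open O ->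
  measurable [set w | O (X w, Y w)].
Proof.
move=> mX mY oO; have [B cB [oB Bbasis]] := V_separable.
pose D := [set UW : set V * set V | [/\ B UW.1, B UW.2 & UW.1 `*` UW.2 `<=` O]].
have -> : [set w | O (X w, Y w)] =
    \bigcup_(UW in D) ([set w | UW.1 (X w)] `&` [set w | UW.2 (Y w)]).
  apply/seteqP; split => [w /= Ow|w [[U W] [_ _ UWO] [/= Uw Ww]]]; last exact: UWO.
  have [[/= P Q] [Pn Qn] PQO] : nbhs (X w, Y w) O.
    exact: open_nbhs_nbhs.
  have [U [BU UX] UP] := Bbasis _ _ Pn.
  have [W [BW WY] WQ] := Bbasis _ _ Qn.
  exists (U, W) => //; split => //= -[x y] [/= Ux Wy].
  by apply: PQO; split; [exact: UP|exact: WQ].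
apply: countable_bigcup_measurable.
  apply: (sub_countable (B := B `*` B)); last exact: countableX.
  by apply: subset_card_le => -[U W] [].
move=> [U W] [/= BU BW _].
by apply: measurableI; apply: measurable_open_preimage => //; exact: oB.
Qed.

Lemma measurable_normB X Y : borel_measurable X -> borel_measurable Y ->
  measurable_fun [set: Omega] (fun w => `|X w - Y w|).
Proof.
move=> mX mY; apply: (measurability _ (RGenOInfty.measurableE R)) => //.
move=> _ [_ [r ->] <-]; rewrite setTI.
pose O := [set xy : V * V | r < `|xy.1 - xy.2|].
have oO : open O.
  apply: (@open_comp _ _ (fun xy : V * V => `|xy.1 - xy.2|) [set x | r < x]);
    last exact: open_gt.
  move=> xy _; apply: cvg_norm.
  by apply: cvgB; [exact: cvg_fst|exact: cvg_snd].
rewrite (_ : _ @^-1` _ = [set w | O (X w, Y w)]).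
  exact: measurable_open_preimage_pair.
by apply/seteqP; split => w; rewrite /O/= in_itv/= andbT.
Qed.

End BorelPairs.

(** * Exceedance events, the exit time and Markov's inequality *)

Section Exit.
Context (R : realType) (V : normedModType R).
Context (d : measure_display) (Omega : measurableType d).
Context (P : probability Omega R).
Implicit Types (T K h gamma p t u : R) (v : R -> Omega -> V) (w : Omega).

(* Rational times make the event measurable; by continuity of the paths nothing
   is lost. *)
Definition exceedance v K t : set Omega :=
  \bigcup_(r in [set r : rat | 0 < (ratr r : R) < t])
    [set w | K < `|v (ratr r) w|].

(** By continuity at the interior time [u], the level is exceeded on a whole neighbourhood of [u],
    which contains a rational time before [t]. *)
Lemma exceedance_path v T K t u w :
  {within `[0, T], continuous (fun t => v t w)} ->
  0 < u < t -> t <= T -> K < `|v u w| -> exceedance v K t w.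
Proof.
move=> cv /andP[u0 ut] tT Kv; have uT : u < T := lt_le_trans ut tT.
have cu : {for u, continuous (fun t => v t w)}.
  apply: (@within_continuous_continuous _ _ _ 0 T); rewrite ?in_itv/= ?u0//.
  exact: lt_trans uT.
have Knear : \forall x \near u, K < `|v x w|.
  by have /cvg_norm/cvgr_gt := cu; apply.
(* Density of the rationals is applied to a nonempty open set, hence the interior; it contains [u]
   because both conditions hold near [u]. *)
pose O := [set x | 0 < x < t /\ K < `|v x w|]^°.
have Ou : O u.
  near=> x; split; last by near: x.
  by apply/andP; split; near: x; [exact: lt_nbhsr|exact: lt_nbhsl].
have [y [Oy [r _ ry]]] := @dense_rat R O (ex_intro _ u Ou) (@open_interior _ _).
move: Oy; rewrite -ry => /interior_subset [rt Kr].
by exists r.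
Unshelve. all: end_near. Qed.

(** A time [u] before [t] in the set defining the infimum would produce a rational exceedance for
    one of the two paths. *)
Lemma le_exit_time v1 v2 T h gamma t w :
  {within `[0, T], continuous (fun t => v1 t w)} ->
  {within `[0, T], continuous (fun t => v2 t w)} ->
  t <= T ->
  ~ exceedance v1 (h `^ (- gamma)) t w -> ~ exceedance v2 (h `^ (- gamma)) t w ->
  (t%:E <= exit_time T h gamma v1 v2 w)%E.
Proof.
move=> cv1 cv2 tT nexc1 nexc2; rewrite le_min lee_fin tT/=.
apply: le_ereal_inf_tmp => _ [u [u0 Kvu] <-]; rewrite lee_fin leNgt; apply/negP => ut.
by case: Kvu => Kvu;
  [apply: nexc1; apply: exceedance_path cv1 _ tT Kvu
  |apply: nexc2; apply: exceedance_path cv2 _ tT Kvu]; rewrite u0.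
Qed.

Lemma measurable_exceedance v T K t : continuous_process T v -> t <= T ->
  measurable (exceedance v K t).
Proof.
move=> [mv _] tT; apply: countable_bigcup_measurable; first exact: countableP.
move=> r /andP[r0 rt].
apply: (@measurable_open_preimage _ _ _ _ _ [set x | K < `|x|]).
  by apply: mv; rewrite in_itv/= (ltW r0)/= (le_trans (ltW rt)).
by apply: (open_comp _ (@open_gt _ K)) => x _; exact: norm_continuous.
Qed.

(** Markov's inequality: K^p times the indicator of the event is at most the supremum over time of
    |v|^p. *)
Lemma probability_exceedance_le v T K t p (C : R) : continuous_process T v ->
  0 < K -> 0 < p -> 0 <= T -> t <= T -> (E_sup P T v p <= C%:E)%E ->
  (P (exceedance v K t) <= (C * K `^ (- p))%:E)%E.
Proof.
move=> cv K0 p0 T0 tT supC; have mA := measurable_exceedance K cv tT.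
have Kp : 0 < K `^ p by rewrite powR_gt0.
rewrite powRN EFinM lee_pdivlMr// muleC.
rewrite -[P _](_ : \int[P]_w (\1_(exceedance v K t) w)%:E = _)%E; last first.
  by rewrite integral_indic// setIT.
rewrite -ge0_integralZl//; last first.
- by rewrite lee_fin ltW.
- by apply/measurable_EFinP; exact: measurable_indic.
(* The majorant is a supremum over uncountably many times, whose measurability is thus never at
   issue. *)
apply: le_trans supC; apply: ge0_le_lower_integral => w.
  by rewrite -EFinM lee_fin mulr_ge0// ltW.
have sup_ge0 : (0 <= ereal_sup [set (`|v t w| `^ p)%:E | t in `[0%R, T]])%E.
  apply: le_ereal_sup_tmp; exists (`|v 0 w| `^ p)%:E; last by rewrite lee_fin powR_ge0.
  by exists 0 => //=; rewrite in_itv/= lexx T0.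
rewrite indicE; have [Aw|nAw] := pselect (exceedance v K t w); last first.
  by rewrite memNset// mule0.
rewrite mem_set// mule1; case: Aw => r /andP[r0 rt] Kr.
apply: le_ereal_sup_tmp; exists (`|v (ratr r) w| `^ p)%:E.
  by exists (ratr r) => //=; rewrite in_itv/= (ltW r0)/= (le_trans (ltW rt)).
by rewrite lee_fin ge0_ler_powR ?nnegrE// ltW.
Qed.

End Exit.

(** * Moments of the error at a fixed time *)

Section Moments.
Context (R : realType) (V : normedModType R).
Context (V_separable : @second_countable V).
Context (d : measure_display) (Omega : measurableType d).
Context (P : probability Omega R).
Implicit Types (T h gamma delta p q s t C : R) (v : R -> Omega -> V).

Lemma measurable_norm_process v T t : continuous_process T v -> t \in `[0, T] ->
  measurable_fun [set: Omega] (fun w => `|v t w|).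
Proof.
move=> [mv _] tT; rewrite (_ : (fun w => _) = (fun w => `|v t w - cst 0 w|)).
  by apply: measurable_normB => //; exact: mv.
by apply/funext => w; rewrite subr0.
Qed.

Lemma measurable_norm_error v1 v2 T t :
  continuous_process T v1 -> continuous_process T v2 -> t \in `[0, T] ->
  measurable_fun [set: Omega] (fun w => `|error v1 v2 t w|).
Proof.
move=> [mv1 _] [mv2 _] tT.
by apply: measurable_normB; [|exact: mv1|exact: mv2].
Qed.

Lemma integral_norm_le v T t s C : t \in `[0, T] -> (sup_E P T v s <= C%:E)%E ->
  (\int[P]_w (`|v t w| `^ s)%:E <= C%:E)%E.
Proof.
move=> tT; apply: le_trans; apply: le_ereal_sup_tmp.
by exists 'E_P[fun w => (`|v t w| `^ s)%R]%E; [exists t|rewrite unlock].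
Qed.

Lemma sup_E_ge0 v T q : 0 <= T -> (0 <= sup_E P T v q)%E.
Proof.
move=> T0; apply: le_ereal_sup_tmp.
exists 'E_P[fun w => (`|v 0 w| `^ q)%R]%E.
  by exists 0 => //=; rewrite in_itv/= lexx.
by apply: expectation_ge0 => w; exact: powR_ge0.
Qed.

Lemma integral_norm_error_le v1 v2 T t s C :
  continuous_process T v1 -> continuous_process T v2 -> t \in `[0, T] -> 0 <= s ->
  (sup_E P T v1 s <= C%:E)%E -> (sup_E P T v2 s <= C%:E)%E ->
  (\int[P]_w (`|error v1 v2 t w| `^ s)%:E <= (2 `^ s * (C + C))%:E)%E.
Proof.
move=> cv1 cv2 tT s0 supv1 supv2.
have mpow v : continuous_process T v ->
    measurable_fun [set: Omega] (fun w => (`|v t w| `^ s)%:E).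
  move=> cv; apply/measurable_EFinP.
  exact: (measurableT_comp (measurable_powR s) (measurable_norm_process cv tT)).
apply: (@le_trans _ _ (\int[P]_w ((2 `^ s)%:E *
    ((`|v1 t w| `^ s)%:E + (`|v2 t w| `^ s)%:E)))%E).
  apply: ge0_le_lower_integral => w; first by rewrite lee_fin powR_ge0.
  by rewrite lee_fin powR_normB.
have pow0 v w : (0 <= (`|v t w| `^ s)%:E)%E by rewrite lee_fin powR_ge0.
rewrite ge0_integralZl ?lee_fin ?powR_ge0//; last 2 first.
- by apply: emeasurable_funD; exact: mpow.
- by move=> w _; rewrite adde_ge0.
rewrite ge0_integralD//; [|exact: mpow|exact: mpow].
rewrite EFinM lee_wpmul2l ?lee_fin ?powR_ge0// EFinD.
by apply: leeD; apply: integral_norm_le tT _.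
Qed.

(** With A the exceedance event, |e|^q <= c1 |e|^s + c2 1_A + c3 |e|^2 1_(~A) + c4 pointwise. The
    integrals are controlled by the s-th moments, Markov's inequality, the error bound up to the
    exit time and the total mass 1, in this order. *)
Lemma integral_error_le v1 v2 T p s q gamma delta h C t (c1 c2 c3 c4 : R) :
  0 < p -> p < s -> 0 < h -> t \in `[0, T] ->
  [/\ 0 <= c1, 0 <= c2, 0 <= c3 & 0 <= c4] ->
  (forall x : R, 0 <= x -> x `^ q <= c1 * x `^ s + c2) ->
  (forall x : R, 0 <= x -> x `^ q <= c1 * x `^ s + c3 * x `^ 2 + c4) ->
  truncated_setting P T p s C gamma delta h v1 v2 ->
  (\int[P]_w (`|error v1 v2 t w| `^ q)%:E <=
    (c1 * (2 `^ s * (C + C)) + (c2 * ((C + C) * h `^ (gamma * p)) +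
      (c3 * h `^ (2 * delta) + c4)))%:E)%E.
Proof.
move=> p0 ps h0 tT [c10 c20 c30 c40] le_exceed le_below.
move=> [[cv1 cv2] [sup1 s1] [sup2 s2] until].
have s0 : 0 < s := lt_trans p0 ps.
have := tT; rewrite in_itv/= => /andP[t0 leT].
set e := fun w => `|error v1 v2 t w|.
pose K := h `^ (- gamma).
(* Taking exceedances before the fixed time [t] gives a measurable event without any measurability
   of the exit time. *)
pose A := exceedance v1 K t `|` exceedance v2 K t.
have K0 : 0 < K by rewrite powR_gt0.
have mA1 := measurable_exceedance K cv1 leT.
have mA2 := measurable_exceedance K cv2 leT.
have mA : measurable A by exact: measurableU.
have me r : measurable_fun [set: Omega] (fun w => e w `^ r).
  apply: (measurableT_comp (measurable_powR r)).
  exact: measurable_norm_error tT.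
have e0 w r : 0 <= e w `^ r by rewrite powR_ge0.
have PA : (P A <= ((C + C) * h `^ (gamma * p))%:E)%E.
  have T0 := le_trans t0 leT.
  have Kp : K `^ (- p) = h `^ (gamma * p) by rewrite -powRrM mulrNN.
  have P1 := probability_exceedance_le cv1 K0 p0 T0 leT sup1; rewrite Kp in P1.
  have P2 := probability_exceedance_le cv2 K0 p0 T0 leT sup2; rewrite Kp in P2.
  rewrite mulrDl EFinD; exact: le_trans (measureU2 _ mA1 mA2) (leeD P1 P2).
have off : (\int[P]_w (e w `^ 2 * \1_(~` A) w)%:E <= (h `^ (2 * delta))%:E)%E.
  apply: le_trans until; apply: ge0_le_lower_integral => w.
    by rewrite lee_fin mulr_ge0.
  have [Aw|nAw] := pselect (A w).
    (* On A the left side vanishes; the supremum is nonnegative because time 0 never comes after the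
       exit time. *)
    rewrite indicE memNset ?mulr0; last by move=> /(_ Aw).
    apply: le_ereal_sup_tmp.
    exists (`|error v1 v2 0 w| `^ 2)%:E; last by rewrite lee_fin powR_ge0.
    exists 0 => //=; split=> //.
    rewrite /exit_time le_min lee_fin (le_trans t0 leT)/=.
    by apply: le_ereal_inf_tmp => _ [u [u0 _] <-]; rewrite lee_fin ltW.
  rewrite indicE mem_set// mulr1; apply: ereal_sup_ubound; exists t => //=; split=> //.
  by apply: le_exit_time leT _ _; [exact: cv1.2|exact: cv2.2
    |move=> ?; apply: nAw; left|move=> ?; apply: nAw; right].
have m2 : measurable_fun [set: Omega] (fun w => (e w `^ 2 * \1_(~` A) w)%:E).
  apply/measurable_EFinP/measurable_funM; first exact: me.
  by apply: measurable_indic; exact: measurableC.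
have mI : measurable_fun [set: Omega] (fun w => (\1_A w : R)%:E).
  by apply/measurable_EFinP; exact: measurable_indic.
(* Measurability and nonnegativity are returned with the integral so that the step can be iterated
   over the nested sum. *)
have integral_scaleD (c : R) (f g : Omega -> \bar R) : 0 <= c ->
    measurable_fun [set: Omega] f -> measurable_fun [set: Omega] g ->
    (forall w, 0 <= f w)%E -> (forall w, 0 <= g w)%E ->
    [/\ measurable_fun [set: Omega] (fun w => c%:E * f w + g w)%E,
        (forall w, 0 <= c%:E * f w + g w)%E &
        (\int[P]_w (c%:E * f w + g w) =
           c%:E * \int[P]_w f w + \int[P]_w g w)%E].
  move=> c0 mf mg f0 g0; have mcf := measurable_funeM c%:E mf.
  have cf0 w : (0 <= c%:E * f w)%E by rewrite mule_ge0.
  split; [exact: emeasurable_funD|by move=> w; rewrite adde_ge0|].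
  by rewrite ge0_integralD// ge0_integralZl.
have mcst : measurable_fun [set: Omega] (cst c4%:E) by exact: measurable_cst.
have [m34 g34 E34] := integral_scaleD c3 _ _ c30 m2 mcst
  (fun w => mulr_ge0 (e0 w 2) (ler0n R _)) (fun=> c40).
have [m234 g234 E234] := integral_scaleD c2 _ _ c20 mI m34
  (fun w => ler0n R _) g34.
have [m1234 g1234 E1234] := integral_scaleD c1 _ _ c10
  ((measurable_EFinP _ _).2 (me s)) m234 (fun w => e0 w s) g234.
apply: (@le_trans _ _ (\int[P]_w (c1%:E * (e w `^ s)%:E + (c2%:E * (\1_A w)%:E +
    (c3%:E * (e w `^ 2 * \1_(~` A) w)%:E + (cst c4%:E w)))))%E).
  apply: ge0_le_lower_integral => w; first by rewrite lee_fin.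
  rewrite lee_fin !indicE in_setC.
  have [Aw|nAw] := boolP (w \in A); rewrite !(mulr1, mulr0, add0r)/=.
    (* On A the term [c4] is still present and is dropped by nonnegativity. *)
    by rewrite addrA ler_wpDr// le_exceed// normr_ge0.
  by rewrite addrA le_below// normr_ge0.
rewrite E1234 E234 E34 integral_indic// setIT.
have -> : (\int[P]_w cst c4%:E w)%E = c4%:E.
  rewrite (integral_cst P measurableT c4%:E) -[RHS]mule1.
  by congr (_ * _)%E; exact: probability_setT.
rewrite !EFinD; apply: leeD; last apply: leeD; last apply: leeD => //.
- rewrite EFinM lee_wpmul2l ?lee_fin//.
  exact: (integral_norm_error_le cv1 cv2 tT (ltW s0) s1 s2).
- by rewrite EFinM lee_wpmul2l ?lee_fin.
- by rewrite EFinM lee_wpmul2l ?lee_fin.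
Qed.

End Moments.

(** * Uniform error bounds and the optimal truncation level *)

Section Rates.
Context (R : realType) (V : normedModType R).
Context (V_separable : @second_countable V).
Context (d : measure_display) (Omega : measurableType d).
Context (P : probability Omega R).
Context (T p s C : R) (p_gt0 : 0 < p) (lt_ps : p < s) (C_gt0 : 0 < C).

Let s_gt0 : 0 < s := lt_trans p_gt0 lt_ps.

(** The summands come from the s-th moment of the error, from Markov's inequality for both
    processes, and from the weights [c3] and [c4], one unit each. *)
Definition error_const := 2 `^ s * (C + C) + (C + C) + 2.

Lemma error_const_gt0 : 0 < error_const.
Proof. by rewrite /error_const !addr_gt0 ?mulr_gt0 ?powR_gt0 ?addr_gt0. Qed.

Lemma sup_E_error_le gamma delta q h (v1 v2 : R -> Omega -> V) :
  0 < gamma -> 0 < delta -> 0 < q <= s -> 0 < h ->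
  truncated_setting P T p s C gamma delta h v1 v2 ->
  (sup_E P T (error v1 v2) q <=
    (error_const * (h `^ exponent_before p gamma delta q +
                    h `^ exponent_after p s gamma q))%:E)%E.
Proof.
move=> g0 d0 qs h0 setting.
have [c1 [c2 [c3 [c4]]]] := interpolation_weights p_gt0 lt_ps g0 d0 qs h0.
set rate := _ + _ => -[c_ge0 le_exceed le_below [r1 r2 r3 r4]].
apply: ge_ereal_sup => _ [t tT <-]; rewrite unlock.
apply: le_trans (integral_error_le V_separable p_gt0 lt_ps h0 tT c_ge0 le_exceed
  le_below setting) _.
have c12 : c1 * (2 `^ s * (C + C)) <= rate * (2 `^ s * (C + C)).
  by rewrite ler_wpM2r// mulr_ge0 ?powR_ge0 ?addr_ge0 ?ltW.
have c22 : (C + C) * (c2 * h `^ (gamma * p)) <= (C + C) * rate.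
  by rewrite ler_wpM2l// addr_ge0 ?ltW.
rewrite lee_fin /error_const mulrCA; lra.
Qed.

(** The solution in gamma of the linear equation that equates the two exponents when delta = (1 -
    rho gamma) / 2. *)
Definition optimal_gamma rho q := q * s / (2 * p * (s - q) + (p + rho) * q * s).

Section OptimalGamma.
Context (rho q : R) (rho_gt0 : 0 < rho) (q_gt0 : 0 < q) (le_qs : q <= s).
Let gamma := optimal_gamma rho q.

Let denominator_gt0 : 0 < 2 * p * (s - q) + (p + rho) * q * s.
Proof.
by rewrite ltr_wpDl ?mulr_ge0 ?subr_ge0 ?mulr_gt0 ?addr_gt0// ltW.
Qed.

Lemma optimal_gamma_gt0 : 0 < gamma.
Proof. by rewrite divr_gt0// mulr_gt0. Qed.

Lemma optimal_delta_gt0 : 0 < (1 - rho * gamma) / 2.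
Proof.
(* The claim becomes that rho q s is less than the denominator, which contains it next to the
   positive summand p q s. *)
rewrite divr_gt0// subr_gt0 /gamma /optimal_gamma mulrA ltr_pdivrMr// mul1r.
rewrite ltr_wpDl ?mulr_ge0 ?subr_ge0 ?(ltW p_gt0)//.
by rewrite mulrDl mulrDl !mulrA ltrDr !mulr_gt0.
Qed.

Lemma exponent_before_optimal :
  exponent_before p gamma ((1 - rho * gamma) / 2) q = q * optimized_rate p s rho q.
Proof.
rewrite /exponent_before /gamma /optimal_gamma /optimized_rate; field.
by rewrite gt_eqF.
Qed.

Lemma exponent_after_optimal :
  exponent_after p s gamma q = q * optimized_rate p s rho q.
Proof.
rewrite /exponent_after /gamma /optimal_gamma /optimized_rate; field.
by rewrite !gt_eqF.
Qed.

(* The first exponent decreases in gamma and the second one increases, so that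
   their minimum is maximal where they cross. *)
Lemma min_exponent_le_optimal gamma' :
  min_exponent p s gamma' ((1 - rho * gamma') / 2) q <=
  min_exponent p s gamma ((1 - rho * gamma) / 2) q.
Proof.
rewrite [leRHS]/min_exponent exponent_before_optimal exponent_after_optimal minxx.
rewrite /min_exponent ge_min; have [gg'|/ltW g'g] := leP gamma gamma'.
  rewrite -exponent_before_optimal /exponent_before ler_wpM2r ?(ltW q_gt0)//.
  have := ler_wpM2l (ltW rho_gt0) gg'; have := ler_wpM2r (ltW p_gt0) gg'; lra.
rewrite -exponent_after_optimal orbC /exponent_after.
by rewrite ler_wpM2r ?divr_ge0 ?subr_ge0 ?ler_wpM2r// ltW.
Qed.

Lemma sup_E_error_optimal h (v1 v2 : R -> Omega -> V) : 0 <= T -> 0 < h ->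
  truncated_setting P T p s C gamma ((1 - rho * gamma) / 2) h v1 v2 ->
  ((sup_E P T (error v1 v2) q) `^ (1 / q) <=
    ((error_const * 2) `^ (1 / q) * h `^ optimized_rate p s rho q)%:E)%E.
Proof.
move=> T_ge0 h0 setting; have q0 : q != 0 by rewrite gt_eqF.
have qs : 0 < q <= s by rewrite q_gt0.
have := sup_E_error_le optimal_gamma_gt0 optimal_delta_gt0 qs h0 setting.
rewrite exponent_before_optimal exponent_after_optimal => sup_le.
have c0 := ltW error_const_gt0.
have bound0 : 0 <= error_const * 2 by rewrite mulr_ge0.
have -> : h `^ optimized_rate p s rho q =
    (h `^ (q * optimized_rate p s rho q)) `^ (1 / q).
  by rewrite -powRrM; congr (_ `^ _); field.
rewrite -powRM ?powR_ge0// -poweR_EFin.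
(* Taking q-th roots is monotone on nonnegative extended reals; the two equal powers of [h] then
   account for the factor 2 in the constant. *)
have sup0 := sup_E_ge0 P (error v1 v2) q T_ge0.
rewrite gt0_ler_poweR ?divr_ge0 ?(ltW q_gt0)//.
- by rewrite in_itv/= sup0 leey.
- by rewrite in_itv/= lee_fin mulr_ge0 ?powR_ge0//= leey.
- by rewrite (le_trans sup_le)// lee_fin -mulrA [in leRHS]mulr_natl mulr2n.
Qed.

End OptimalGamma.
End Rates.

Unset Implicit Arguments.
Set Strict Implicit.

Theorem lemma4p3 (R : realType) (V : normedModType R)
    (V_separable : @second_countable V)
    (d : measure_display) (Omega : measurableType d) (P : probability Omega R)
    (T p s Cstar : R)
    (T_gt0 : 0 < T) (p_gt0 : 0 < p) (lt_ps : p < s) (Cstar_gt0 : 0 < Cstar) :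
  (forall gamma delta q : R, 0 < gamma -> 0 < delta -> 0 < q <= s ->
     [/\ exists Const : R, 0 < Const /\
           (forall (h : R) (v1 v2 : R -> Omega -> V), 0 < h ->
              truncated_setting P T p s Cstar gamma delta h v1 v2 ->
              (sup_E P T (error v1 v2) q <=
                (Const * (h `^ exponent_before p gamma delta q +
                          h `^ exponent_after p s gamma q))%:E)%E),
         exists Const : R, 0 < Const /\
           (forall (h : R) (v1 v2 : R -> Omega -> V), 0 < h <= 1 ->
              truncated_setting P T p s Cstar gamma delta h v1 v2 ->
              (sup_E P T (error v1 v2) q <=
                (Const * h `^ min_exponent p s gamma delta q)%:E)%E) &
         is_effective_rate
           (fun h => h `^ exponent_before p gamma delta q +
                     h `^ exponent_after p s gamma q)
           (min_exponent p s gamma delta q)]) /\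
  (forall rho : R, 0 < rho ->
     (forall q : R, 0 < q <= s ->
        exists gamma : R,
          [/\ 0 < gamma,
              0 < (1 - rho * gamma) / 2,
              forall gamma' : R, 0 < gamma' -> 0 < (1 - rho * gamma') / 2 ->
                min_exponent p s gamma' ((1 - rho * gamma') / 2) q <=
                min_exponent p s gamma ((1 - rho * gamma) / 2) q &
              exists C : R, 0 < C /\
                (forall (h : R) (v1 v2 : R -> Omega -> V), 0 < h ->
                   truncated_setting P T p s Cstar
                     gamma ((1 - rho * gamma) / 2) h v1 v2 ->
                   ((sup_E P T (error v1 v2) q) `^ (1 / q) <=
                     (C * h `^ optimized_rate p s rho q)%:E)%E)]) /\
     optimized_rate p s rho q @[q --> 0^'+] --> (1 / 2 : R)).
Proof.
have s_gt0 := lt_trans p_gt0 lt_ps.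
split=> [gamma delta q g0 d0 qs|rho rho0].
  split; last exact: is_effective_rate_powR.
    exists (error_const s Cstar); split; first exact: error_const_gt0.
    by move=> h v1 v2 h0; exact: sup_E_error_le.
  (* For h <= 1 each power of [h] is at most the one with the smaller exponent, hence the factor
     2. *)
  exists (error_const s Cstar * 2); split.
    by rewrite mulr_gt0// error_const_gt0.
  move=> h v1 v2 h01 setting; have /andP[h0 _] := h01.
  apply: le_trans (sup_E_error_le V_separable p_gt0 lt_ps Cstar_gt0 g0 d0 qs h0
    setting) _.
  by rewrite lee_fin -mulrA ler_wpM2l ?add_powR_le_min// ltW// error_const_gt0.
split; last exact: optimized_rate_cvg.
move=> q /andP[q0 qs]; exists (optimal_gamma p s rho q); split.
- exact: optimal_gamma_gt0.
- exact: optimal_delta_gt0.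
- by move=> gamma' _ _; exact: min_exponent_le_optimal.
- exists ((error_const s Cstar * 2) `^ (1 / q)); split.
    by rewrite powR_gt0// mulr_gt0// error_const_gt0.
  by move=> h v1 v2 h0; exact: sup_E_error_optimal (ltW T_gt0) h0.
Qed.
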